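(* Let $f : [1,\infty) \to [1,\infty)$ be an increasing bijection, and let $P$ be a hereditary property of graphs with speed at most $f$. Let $k \geq 1$ be real. Then any graph $G \in P$ with $\iota(G) > 18k + 4$ contains cycles of at least $\frac{1}{2}f^{-1}(k)$ consecutive lengths, i.e. there is an integer $m$ such that $G$ contains a cycle of length $\ell$ for every integer $\ell$ with $m \le \ell < m + \frac12 f^{-1}(k)$.
   Context: All graphs are finite and simple. For nonempty $X \subseteq V(G)$, $\alpha(X)$ is the independence number of the subgraph induced by $X$, and the independence ratio is $\iota(G) := \sup_{\emptyset\neq X \subseteq V(G)} |X|/\alpha(X)$. A hereditary property is a family of graphs closed under isomorphism and under taking induced subgraphs. A hereditary property $P$ has speed at most $f$ if for every $n \in \mathbb{N}$ and every $n$-vertex graph $G \in P$, $\iota(G) \leq f(n)$. *)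

(* Defs.v *)
From HB Require Import structures.
From mathcomp Require Import all_boot all_order all_algebra.
From mathcomp Require Import all_classical.
From mathcomp Require Import reals.

Set Implicit Arguments.
Unset Strict Implicit.
Unset Printing Implicit Defensive.

Import Order.TTheory GRing.Theory Num.Theory.

Local Open Scope ring_scope.

Record sgraph := SGraph {
  vertex :> finType;
  edge : rel vertex;
  edge_sym : symmetric edge;
  edge_irrefl : irreflexive edge
}.

Definition graph_iso (G H : sgraph) : Prop :=
  exists2 phi : G -> H, bijective phi & {mono phi : x y / edge x y}.

Definition induced_edge (G : sgraph) (X : {set G}) : rel {x : G | x \in X} :=
  fun u v => edge (val u) (val v).

Lemma induced_edge_sym (G : sgraph) (X : {set G}) : symmetric (@induced_edge G X).
Proof. by move=> u v; apply: edge_sym. Qed.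

Lemma induced_edge_irrefl (G : sgraph) (X : {set G}) :
  irreflexive (@induced_edge G X).
Proof. by move=> u; apply: edge_irrefl. Qed.

Definition induced (G : sgraph) (X : {set G}) : sgraph :=
  SGraph (@induced_edge_sym G X) (@induced_edge_irrefl G X).

Definition independent (G : sgraph) (A : {set G}) : bool :=
  [forall x in A, forall y in A, ~~ edge x y].

Definition alpha (G : sgraph) : nat :=
  \max_(A : {set G} | independent A) #|A|.

(* On the graph without vertices the supremum is over the empty set and, by
   the convention of [sup], equals 0. *)
Definition indep_ratio (R : realType) (G : sgraph) : R :=
  sup [set #|X|%:R / (alpha (induced X))%:R | X in [set X : {set G} | X != finset.set0]].

Definition hereditary (P : sgraph -> Prop) : Prop :=
  (forall G H : sgraph, graph_iso G H -> P G -> P H) /\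
  (forall (G : sgraph) (X : {set G}), P G -> P (induced X)).

(* The order n is positive because f is only meaningful on [1, +oo[. *)
Definition speed_at_most (R : realType) (f : R -> R) (P : sgraph -> Prop) : Prop :=
  forall (n : nat) (G : sgraph), (0 < n)%N -> #|G| = n -> P G ->
    indep_ratio R G <= f n%:R.

(* A cycle is the cyclic sequence of its (distinct) vertices; at least three
   are required because [ucycle] also accepts [::] and [:: x; y]. *)
Definition has_cycle (G : sgraph) (l : int) : Prop :=
  exists c : seq G, [/\ (3 <= size c)%N, ucycle (@edge G) c & l = size c].

(* Main.v *)
(** Breadth-first layers alternate in parity and edges stay within a layer or
    join consecutive ones, so some component H of a layer has independence ratio
    above 9k + 2. Let w be the lowest common ancestor of H in the search tree;
    splitting H into the descendants of one child of w and the rest, any two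
    vertices from different parts are joined through the tree, outside H, by
    paths of one and the same length. One of the parts, A, still has ratio above
    c = (18k + 4) / 4, and in a minimal subset of A with this property closed
    neighbourhoods of independent sets I have more than c|I| elements. The speed
    bound gives each set of t = floor (f^-1(k)) vertices an independent subset of
    size t/k, hence a closed neighbourhood of more than 4t vertices, so
    depth-first search must at some moment have more than t vertices on its
    stack: A contains a path with more than t vertices. Joining this path within
    H to the other part at a vertex x, the longer of its two segments at x gives
    paths between the parts of at least t/2 consecutive lengths, which the tree
    closes to cycles. *)
Require Import Defs.
From HB Require Import structures.
From mathcomp Require Import all_boot all_order all_algebra.
From mathcomp Require Import zify lra.

Set Implicit Arguments.
Unset Strict Implicit.
Unset Printing Implicit Defensive.

Import Order.TTheory GRing.Theory Num.Theory.

(** * Paths in finite graphs *)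

(** Whenever [q] meets [p] again, restart from the meeting point. The remaining path is strictly
    shorter, so this stops at the last visit to [p]. *)
Lemma last_exit (T : eqType) (e : rel T) (p : seq T) (x : T) (q : seq T) :
  x \in p -> path e x q -> uniq (x :: q) ->
  exists (y : T) (q' : seq T), [/\ y \in p, path e y q', uniq (y :: q'),
    last y q' = last x q & {in q', forall z, z \notin p}].
Proof.
have [n ltqn] := ubnP (size q).
elim: n => // n IHn in x q ltqn * => xp xq uq.
have [/hasP[z zq zp]|/hasPn noq] := boolP (has (mem p) q); last by exists x, q; split.
case/path.splitP: zq xq uq ltqn => q1 q2.
rewrite cat_rcons size_cat cat_path last_cat -cat_cons cat_uniq /=.
move=> /and3P[_ _ zq2] /and3P[_ _ uq] ltqn.
by apply: (IHn z q2) => //; lia.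
Qed.

Section Paths.
Variables (T : finType) (e : rel T).
Hypothesis e_sym : symmetric e.

(* A state of depth-first search: S is the set of exhausted vertices, p the stack
   with its top first; each step increases 2|S| + |p|. *)
Lemma dfs_separation (V : {set T}) (t : nat) : t <= #|V| ->
  exists (S : {set T}) (p : seq T),
    [/\ #|S| = t, S \subset V, {subset p <= V} & sorted e p /\ uniq p] /\
    {in S & V, forall x y, e x y -> y \in S \/ y \in p}.
Proof.
move=> le_tV.
(* [S] and the stack are disjoint subsets of [V], so [2|S| + |p|] never exceeds [2|V|]. At
   [n = 2|V| + 1] only [|S| = t] is left. *)
suff /(_ #|V|.*2.+1) : forall n, exists (S : {set T}) (p : seq T),
    [/\ #|S| <= t, S \subset V, {subset p <= V}, sorted e p /\ uniq p &
      {in S, forall x, x \notin p}] /\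
    {in S & V, forall x y, e x y -> y \in S \/ y \in p} /\
    (#|S| = t \/ n <= #|S|.*2 + size p).
  move=> [S [p [[leSt sSV sp [srt up] dj] [cl [cS|big]]]]].
    by exists S, p; do !split.
  have : #|S| + size p <= #|V|.
    rewrite -(card_uniqP up) -[X in X + _](eq_card (A := mem S))//.
    rewrite -cardUI [X in _ + X]eq_card0 ?addn0; last first.
      by move=> x; rewrite !inE; apply/andP => -[/dj/negP].
    by apply/subset_leq_card/subsetP => x; rewrite !inE => /orP[/(subsetP sSV)|/sp].
  have := subset_leq_card sSV; lia.
elim=> [|n [S [p [[leSt sSV sp [srt up] dj] [cl big]]]]].
  exists set0, [::]; do !split=> //; rewrite ?cards0 ?sub0set//.
  - by move=> x y; rewrite inE.
  - by right.
case: big => [cS|big]; first by exists S, p; do !split => //; left.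
have [cS|ltSt] := eqVneq #|S| t; first by exists S, p; do !split => //; left.
have {}ltSt : #|S| < t by rewrite ltn_neqAle ltSt.
(* Push a new vertex adjacent to the top if there is one; on an empty stack any new vertex
   qualifies. Otherwise pop. *)
have [/existsP[y /andP[yU spy]]|/existsPn noext] :=
  boolP [exists y, (y \in V :\: (S :|: [set x in p])) && sorted e (y :: p)].
  move: yU; rewrite !inE negb_or => /andP[/andP[yS yp] yV].
  exists S, (y :: p); do !split => //=.
  - by move=> z; rewrite inE => /orP[/eqP->|/sp].
  - by rewrite yp.
  - move=> x xS; rewrite inE negb_or dj// andbT.
    by apply: contraNneq yS => <-.
  - by move=> x z xS zV /(cl x z xS zV)[]; rewrite inE; [left|right; apply/orP; right].
  - by right; lia.
case: p => [|a p] in sp srt up dj cl big noext *.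
  have [y yV yS] : exists2 y, y \in V & y \notin S.
    apply/subsetPn; apply/negP => /subset_leq_card; lia.
  by have := noext y; rewrite !inE yV (negbTE yS).
have aS : a \notin S by apply/negP => /dj; rewrite inE eqxx.
move: up => /= /andP[ap up].
(* The popped top has no new neighbour left, so the separation survives, and [2|S| + |p|] changes by
   [2 - 1]. *)
exists (a |: S), p; do !split => //.
- by rewrite cardsU1 aS.
- by rewrite subUset sub1set sSV sp ?mem_head.
- by move=> z zp; apply: sp; rewrite inE zp orbT.
- exact: path_sorted srt.
- move=> x; rewrite !inE => /orP[/eqP->//|/dj].
  by rewrite inE negb_or => /andP[].
- move=> x y; rewrite !inE => /orP[/eqP->|xS] yV xy; last first.
    case: (cl x y xS yV xy) => [->|]; first by rewrite orbT; left.
    by rewrite inE => /orP[->|]; [left|right].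
  have := noext y; rewrite !inE /= e_sym xy yV (srt : path e a p) !andbT negbK.
  by case/or3P=> ->; rewrite ?orbT; [left|left|right].
- by right; rewrite cardsU1 aS /=; move: big => /=; lia.
Qed.

(** Start [s] steps along [p], walk back to [x] and continue along [q]. The free choice of [s] is
    the source of consecutive lengths. *)
Lemma fork_path (x : T) (p q : seq T) (s : nat) :
  path e x p -> path e x q -> uniq (x :: p) -> uniq (x :: q) ->
  {in q, forall z, z \notin x :: p} -> s <= size p ->
  exists (z : T) (w : seq T), [/\ z \in x :: p, path e z w, uniq (z :: w), last z w = last x q
    & size w = s + size q] /\ {subset z :: w <= x :: p ++ q}.
Proof.
move=> xp xq up uq dj les.
pose p1 := take s p.
have sp1 : size p1 = s by rewrite size_takel.
have xp1 : path e x p1 by move: xp; rewrite -{1}(cat_take_drop s p) cat_path => /andP[].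
have subp1 : {subset x :: p1 <= x :: p}.
  by move=> z; rewrite !inE => /orP[->//|/mem_take->]; rewrite orbT.
have up1 : uniq (x :: p1).
  by move: up; rewrite -{1}(cat_take_drop s p) -cat_cons cat_uniq => /andP[].
have E : last x p1 :: rev (belast x p1) = rev (x :: p1) by rewrite [x :: p1]lastI rev_rcons.
exists (last x p1), (rev (belast x p1) ++ q).
have ll : last (last x p1) (rev (belast x p1)) = x.
  rewrite -[LHS]/(last x (last x p1 :: rev (belast x p1))).
  by rewrite E rev_cons last_rcons.
rewrite -!cat_cons E; split; first split.
- by apply: subp1; apply: mem_last.
- rewrite cat_path ll xq andbT rev_path.
  by rewrite (eq_path (e' := e)).
- rewrite cat_uniq rev_uniq up1 /=; move: uq => /= /andP[_ ->]; rewrite andbT.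
  apply/hasPn => z zq; rewrite mem_rev; apply/negP => /subp1.
  by apply/negP/dj.
- by rewrite last_cat ll.
- by rewrite size_cat size_rev size_belast sp1.
- move=> z; rewrite !mem_cat mem_rev => /orP[/subp1->//|->]; by rewrite orbT.
Qed.

(** A connection inside [H] leaves [p] for the last time at [x] and ends at [b] in [B]. The closing
    path outside [H] has [n] inner vertices whatever its ends, so moving the starting point along
    [p] changes the cycle length by exactly that shift. *)
Lemma consecutive_cycles (H A B : {set T}) (n : nat) (p : seq T) :
  A \subset H -> B \subset H -> [disjoint A & B] -> B != set0 ->
  {in H &, forall x y, connect [rel x y | e x y && (y \in H)] x y} ->
  0 < n ->
  (forall a b, a \in A -> b \in B -> exists u,
      [/\ size u = n, path e b (rcons u a), uniq u & {in u, forall x, x \notin H}]) ->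
  sorted e p -> uniq p -> {subset p <= A} ->
  exists m, forall s, s.*2 < size p ->
    exists c, [/\ 3 <= size c, ucycle e c & size c = m + s].
Proof.
move=> sAH sBH dAB /set0Pn[b bB] cH n0 tree srt up spA.
case Ep: p => [|a p0]; first by exists 0.
have ap : a \in p by rewrite Ep mem_head.
have aA := spA a ap.
have /connectP[q0 pq0 bq] := cH a b (subsetP sAH a aA) (subsetP sBH b bB).
case/shortenP: pq0 bq => q1 pq1 uq1 _ bq.
have [x [q [xp pq uq lq qp]]] := last_exit ap pq1 uq1.
rewrite -bq {q1 pq1 uq1 bq} in lq.
rewrite -Ep => {a p0 Ep ap aA q0}.
have xA := spA x xp.
(* Together with [0 < n] this gives the cycle its three vertices. *)
have q0 : 0 < size q.
  case: (q) lq => [|//] /= xb; have := disjointFr dAB xA; rewrite xb bB //.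
have qH : {subset q <= H}.
  elim: (q) (x) pq => [//|y q2 IHq] v /= /andP[/andP[_ yH] /IHq qH] w.
  by rewrite inE => /orP[/eqP->|/qH].
have eq : path e x q by apply: sub_path pq => v w /andP[].
(* The cycle consists of [z], the [s + size q] further vertices inside [H] and the [n] vertices
   outside. *)
exists (size q + n.+1) => s lts.
(* The vertex [x] cuts [p] into two segments with [size p - 1 >= 2s] other vertices in total; the
   longer one serves, reversed if it precedes [x]. *)
have [p1 [xp1 up1 les sp1]] : exists p1 : seq T, [/\ path e x p1, uniq (x :: p1),
    s <= size p1 & {subset x :: p1 <= p}].
  have [p2 [p3 Ep]] : exists p2 p3 : seq T, p = p2 ++ x :: p3.
    by case/path.splitPr: xp => p2 p3; exists p2, p3.
  move: srt up lts; rewrite Ep -cat_rcons => srt up.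
  rewrite size_cat size_rcons => lts.
  have [les|lts'] := leqP s (size p3).
    exists p3; split=> //.
    - by move: srt; rewrite cat_rcons => /cat_sorted2[].
    - by move: up; rewrite cat_rcons cat_uniq => /and3P[].
    - by move=> z; rewrite cat_rcons mem_cat => ->; rewrite orbT.
  exists (rev p2); split=> //.
  - move: srt => /cat_sorted2[+ _]; rewrite -rev_sorted rev_rcons /=.
    by rewrite (eq_path (e' := e)).
  - by rewrite -rev_rcons rev_uniq; move: up; rewrite cat_uniq => /and3P[].
  - by rewrite size_rev; lia.
  - by move=> z; rewrite -rev_rcons mem_rev mem_cat => ->.
have qp1 : {in q, forall z, z \notin x :: p1}.
  by move=> z /qp; apply: contra => /sp1.
have [z [w [[zp1 zw uzw lw sw] szw]]] := fork_path xp1 eq up1 uq qp1 les.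
have [u [su bu uu uH]] := tree z b (spA z (sp1 z zp1)) bB.
exists (z :: w ++ u); split.
- rewrite /= size_cat sw su ltnS -addnA.
  by apply: (leq_trans _ (leq_addl _ _)); apply: (leq_add q0 n0).
- rewrite /ucycle -cat_cons cat_uniq uzw uu andbT.
  rewrite /= rcons_cat cat_path zw lw lq bu /=.
  apply/hasPn => v /uH; apply: contra => /szw.
  by rewrite -cat_cons mem_cat => /orP[/sp1/spA/(subsetP sAH)|/qH].
- by rewrite /= size_cat sw su -addnA addnC addnS.
Qed.

End Paths.

(** * Breadth-first layers *)

Section Layers.
Variables (T : finType) (e : rel T).
Hypothesis e_sym : symmetric e.

(** A breadth-first spanning forest, as connectedness is not assumed: [depth0_inj] says that each
    component has at most one root. [parent] is meaningful only at positive depth. *)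
Record layering := Layering {
  depth : T -> nat;
  parent : T -> T;
  depth_edge : forall x y, e x y -> depth y <= (depth x).+1;
  parent_edge : forall x, 0 < depth x -> e x (parent x);
  depth_parent : forall x, 0 < depth x -> depth x = (depth (parent x)).+1;
  depth0_inj : forall x y, connect e x y -> depth x = 0 -> depth y = 0 -> x = y
}.

(** The roots are the canonical representatives of the components, and the depth is the least radius
    of a ball around the roots that contains the vertex. *)
Lemma layering_exists : inhabited layering.
Proof.
have sc : connect_sym e := sym_connect_sym e_sym.
pose grow (S : {set T}) := S :|: [set y | [exists x in S, e x y]].
pose ball n := iter n grow [set x | fingraph.root e x == x].
have ball_edge n x y : x \in ball n -> e x y -> y \in ball n.+1.
  move=> xn xy; rewrite /= !inE; apply/orP; right.
  by apply/existsP; exists x; rewrite xn.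
have ball_path p r n : path e r p -> r \in ball n -> exists m, last r p \in ball m.
  elim: p r n => [|y p IHp] r n /= pp rn; first by exists n.
  by case/andP: pp => ry pp; apply: (IHp y n.+1) => //; apply: ball_edge ry.
have ball_ex x : exists n, x \in ball n.
  have /connectP[p pp ->] : connect e (fingraph.root e x) x.
    by rewrite sc connect_root.
  by apply: (ball_path p _ 0 pp); rewrite inE root_root.
pose d x := ex_minn (ball_ex x).
have dP x : x \in ball (d x) by rewrite /d; case: ex_minnP.
have d_min x n : x \in ball n -> d x <= n.
  by rewrite /d; case: ex_minnP => m _ + xn; apply.
have d_edge x y : e x y -> d y <= (d x).+1.
  by move=> xy; apply/d_min/(ball_edge _ x).
pose par x := odflt x [pick y | e x y && (d x == (d y).+1)].
have parP x : 0 < d x -> e x (par x) && (d x == (d (par x)).+1).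
  rewrite /par; case: pickP => [y //|noy] dx.
  have := dP x; move Ed: (d x) dx => [//|n] _.
  rewrite /= !inE => /orP[/d_min|/existsP[y /andP[yn yx]]].
    by rewrite Ed ltnn.
  have := noy y; rewrite e_sym yx Ed eqSS.
  by rewrite eq_sym eqn_leq d_min//= -ltnS -Ed d_edge.
exists; exists d par => [x y /d_edge//|x /parP/andP[]//|x /parP/andP[_ /eqP]//|x y].
move=> xy dx dy; have := dP x; have := dP y; rewrite dx dy !inE => /eqP <- /eqP <-.
by apply/eqP; rewrite root_connect.
Qed.

Variable L : layering.
Notation d := (depth L).
Notation par := (parent L).

Lemma depth_iter_parent k x : k <= d x -> d (iter k par x) + k = d x.
Proof.
elim: k => [|k IHk] ltkd; first by rewrite addn0.
have eqd := IHk (ltnW ltkd).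
have dx : 0 < d (iter k par x) by lia.
by rewrite iterS -eqd (depth_parent dx) addSnnS.
Qed.

Lemma parent_path x k : k <= d x -> path e x (traject par (par x) k).
Proof.
elim: k x => [//|k IHk] x ltkd /=.
have dx : 0 < d x by lia.
by rewrite parent_edge//= IHk//; have := depth_parent dx; lia.
Qed.

Lemma depth_traject x k y : k <= d x -> y \in traject par (par x) k -> d y < d x.
Proof.
move=> lekd /trajectP[i ltik ->]; rewrite -iterSr.
by rewrite -[ltnRHS](depth_iter_parent (leq_trans ltik lekd)) addnS ltnS leq_addr.
Qed.

Lemma uniq_traject_parent x k : k <= d x -> uniq (traject par (par x) k).
Proof.
elim: k x => [//|k IHk] x ltkd /=.
have dx : 0 < d x by lia.
have ltkp : k <= d (par x) by have := depth_parent dx; lia.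
by rewrite IHk// andbT; apply/negP => /(depth_traject ltkp); rewrite ltnn.
Qed.

Lemma parent_connect x k : k <= d x -> connect e x (iter k par x).
Proof.
move=> lekd; apply/connectP; exists (traject par (par x) k).
  exact: parent_path.
by rewrite last_traject.
Qed.

(** Let [j.+1] be the least height at which all vertices of [H] have the same ancestor [w]. One
    height lower the ancestors are children of [w] and still differ; they define the split. *)
Lemma layer_split (H : {set T}) (i : nat) :
  {in H, forall x, d x = i} -> {in H &, forall x y, connect e x y} -> 1 < #|H| ->
  exists (A : {set T}) (n : nat), [/\ A \subset H, A != set0, H :\: A != set0, 0 < n &
    forall a b, a \in A -> b \in H :\: A -> exists u,
      [/\ size u = n, path e a (rcons u b), uniq u & {in u, forall x, d x < i}]].
Proof.
move=> dH cH /card_gt1P[x0 [y0 [x0H y0H xy0]]].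
pose const j := [forall x in H, forall y in H, iter j par x == iter j par y].
(* At height [i] every vertex of [H] has reached depth 0, and the root is unique since [H] lies in
   one component. *)
have consti : const i.
  apply/forall_inP => x xH; apply/forall_inP => y yH; apply/eqP.
  have dx : i <= d x by rewrite dH.
  have dy : i <= d y by rewrite dH.
  have ix := depth_iter_parent dx; have iy := depth_iter_parent dy.
  have dx' := dH x xH; have dy' := dH y yH.
  apply: (@depth0_inj L); [|lia|lia].
  apply: (connect_trans (y := y)); last by apply: parent_connect; lia.
  apply: (connect_trans (y := x)); last exact: cH.
  by rewrite (sym_connect_sym e_sym) parent_connect//; lia.
have [j cj minj] := ex_minnP (ex_intro const i consti).
have leji : j <= i by exact: minj.
case: j => [|j] in cj minj leji *.
  move/forall_inP/(_ x0 x0H)/forall_inP/(_ y0 y0H): cj => /= /eqP eqxy.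
  by rewrite eqxy eqxx in xy0.
have /forall_inPn[a0 a0H /forall_inPn[b0 b0H ab0]] : ~~ const j.
  by apply/negP => /minj; rewrite ltnn.
pose A := [set x in H | iter j par x == iter j par a0].
(* Going up from [a] to [w] gives [j.+1] inner vertices, [w] included; going down to [b] gives [j]
   more. *)
exists A, (j.+1 + j); split=> //.
- by apply/subsetP => x; rewrite inE => /andP[].
- by apply/set0Pn; exists a0; rewrite !inE a0H eqxx.
- by apply/set0Pn; exists b0; rewrite !inE b0H andbT eq_sym.
move=> a b; rewrite !inE => /andP[aH ea] /andP[+ bH]; rewrite bH /= => eb.
have da : j.+1 <= d a by rewrite dH.
have db : j.+1 <= d b by rewrite dH.
have db' := ltnW db.
have eqw : iter j.+1 par a = iter j.+1 par b.
  by move/forall_inP/(_ a aH)/forall_inP/(_ b bH)/eqP: cj.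
exists (traject par (par a) j.+1 ++ rev (traject par (par b) j)); split.
- by rewrite size_cat size_rev !size_traject.
- rewrite rcons_cat cat_path parent_path// last_traject eqw.
  have := parent_path db; rewrite trajectSr -iterSr => pb.
  have := rev_path e b (rcons (traject par (par b) j) (iter j.+1 par b)).
  rewrite last_rcons belast_rcons rev_cons => ->.
  by rewrite (eq_path (e' := e)).
- rewrite cat_uniq rev_uniq !uniq_traject_parent// andbT.
  (* By depth, a common vertex of the two branches has the same height above [a] and [b]. Then their
     ancestors at height [j] agree too, which would put [b] into [A]. *)
  apply/hasPn => y; rewrite mem_rev => /trajectP[s lts ->].
  apply/negP => /trajectP[r ltr].
  rewrite -!iterSr => eqsr.
  have : r = s.
    have := depth_iter_parent (leq_trans ltr da).
    have := depth_iter_parent (leq_trans lts db').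
    by rewrite eqsr (dH a aH) (dH b bH) => <- /addnI[].
  move=> ers; rewrite {r}ers in ltr eqsr.
  move: eb; rewrite -(eqP ea) => /eqP; apply.
  by rewrite -(subnK lts) !iterD eqsr.
- move=> y; rewrite mem_cat mem_rev -[X in _ < X](dH a aH).
  move=> /orP[/(depth_traject da)//|/(depth_traject db')].
  by rewrite (dH a aH) (dH b bH).
Qed.

End Layers.

(** * Independence ratio *)

Section Independence.
Variable G : sgraph.
Implicit Types (X Y I J : {set G}).

(** Taken inside [G] rather than on [induced X], so that different subsets can be compared directly;
    [alpha_induced] links the two. *)
Definition alpha_in X := \max_(I : {set G} | (I \subset X) && independent I) #|I|.

Lemma independentP I :
  reflect {in I &, forall x y, ~~ edge x y} (independent I).
Proof.
apply: (iffP forall_inP) => [iI x y xI yI|iI x xI]; first exact: (forall_inP (iI x xI)).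
by apply/forall_inP => y yI; apply: iI.
Qed.

Lemma independent0 : independent (set0 : {set G}).
Proof. by apply/independentP => x y; rewrite inE. Qed.

Lemma alpha_in_attained X :
  exists I, [/\ I \subset X, independent I & #|I| = alpha_in X].
Proof.
have [|I] := @eq_bigmax_cond _
    [pred I : {set G} | (I \subset X) && independent I] (fun I => #|I|).
  by apply/card_gt0P; exists set0; rewrite inE sub0set independent0.
by rewrite inE => /andP[sIX iI] eI; exists I; split; rewrite // -eI.
Qed.

Lemma leq_alpha_in I X : I \subset X -> independent I -> #|I| <= alpha_in X.
Proof.
move=> sIX iI; apply: (@leq_bigmax_cond _ _ (fun I : {set G} => #|I|)).
by rewrite sIX iI.
Qed.

Lemma alpha_inS X Y : X \subset Y -> alpha_in X <= alpha_in Y.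
Proof.
move=> sXY; have [I [sIX iI <-]] := alpha_in_attained X.
exact: leq_alpha_in (subset_trans sIX sXY) iI.
Qed.

Lemma alpha_in_gt0 X : X != set0 -> 0 < alpha_in X.
Proof.
move=> /set0Pn[x xX]; rewrite -(cards1 x); apply: leq_alpha_in.
  by rewrite sub1set.
by apply/independentP => y z /set1P -> /set1P ->; rewrite edge_irrefl.
Qed.

Lemma alpha_in_setT : alpha_in [set: G] = alpha G.
Proof. by apply: eq_bigl => I; rewrite subsetT. Qed.

End Independence.
Arguments independentP {G I}.

Lemma alpha_induced (G : sgraph) (X : {set G}) : alpha (induced X) = alpha_in X.
Proof.
apply/eqP; rewrite eqn_leq; apply/andP; split.
  apply/bigmax_leqP => I /independentP iI.
  rewrite -(card_imset (mem I) val_inj); apply: leq_alpha_in.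
    by apply/subsetP => _ /imsetP[x _ ->]; apply: valP.
  by apply/independentP => _ _ /imsetP[x xI ->] /imsetP[y yI ->]; apply: (iI x y).
have [I [/subsetP sIX /independentP iI <-]] := alpha_in_attained X.
pose J : {set induced X} := [set x | val x \in I].
have -> : I = [set val x | x in J].
  apply/setP => x; apply/idP/imsetP => [xI|[y + ->]]; last by rewrite inE.
  by exists (Sub x (sIX x xI)); rewrite ?inE SubK.
rewrite (card_imset (mem J) val_inj) -alpha_in_setT.
apply: leq_alpha_in; first exact: subsetT.
by apply/independentP => x y; rewrite !inE; apply: iI.
Qed.

(** * Bounded independence ratio, critical sets and long paths *)

Section RatioLe.
Local Open Scope ring_scope.
Variables (R : realFieldType) (G : sgraph).
Implicit Types (X Y I J : {set G}) (c : R).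

(** Multiplied out, the bound on the ratio needs neither a supremum nor an exception for the empty
    set. *)
Definition ratio_le c X :=
  [forall Y : {set G}, (Y \subset X) ==> (#|Y|%:R <= c * (alpha_in Y)%:R)].

Lemma ratio_leP c X :
  reflect (forall Y, Y \subset X -> #|Y|%:R <= c * (alpha_in Y)%:R) (ratio_le c X).
Proof. by apply: (iffP forallP) => h Y; [apply/implyP|apply/implyP/h]. Qed.

Lemma ratio_leS c X Y : X \subset Y -> ratio_le c Y -> ratio_le c X.
Proof.
move=> sXY /ratio_leP bY; apply/ratio_leP => Z sZX.
by apply: bY; apply: subset_trans sXY.
Qed.

(** Cut a subset into its parts inside and outside [X]; neither part has a larger independence
    number than the whole. *)
Lemma ratio_leU a b X Y : 0 <= a -> 0 <= b ->
  ratio_le a X -> ratio_le b Y -> ratio_le (a + b) (X :|: Y).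
Proof.
move=> a0 b0 /ratio_leP bX /ratio_leP bY; apply/ratio_leP => Z sZ.
have Z1X : Z :&: X \subset X by apply: subsetIr.
have Z2Y : Z :\: X \subset Y by rewrite subDset.
have a1 : (alpha_in (Z :&: X))%:R <= (alpha_in Z)%:R :> R.
  by rewrite ler_nat alpha_inS// subsetIl.
have a2 : (alpha_in (Z :\: X))%:R <= (alpha_in Z)%:R :> R.
  by rewrite ler_nat alpha_inS// subsetDl.
rewrite -(cardsID X Z) natrD mulrDl lerD//.
  exact: le_trans (bX _ Z1X) (ler_wpM2l a0 a1).
exact: le_trans (bY _ Z2Y) (ler_wpM2l b0 a2).
Qed.

Lemma card_fibers (K : finType) (g : G -> K) Y :
  #|Y| = (\sum_k #|Y :&: [set x | g x == k]|)%N.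
Proof.
rewrite -sum1_card (partition_big g predT)//=; apply: eq_bigr => k _.
by rewrite -sum1_card; apply: eq_bigl => x; rewrite !inE.
Qed.

(** No edge within [X] joins two fibers, so maximum independent sets of the fibers unite to an
    independent set, and the bounds add up. *)
Lemma ratio_le_fibers (K : finType) (g : G -> K) c X : 0 <= c ->
  {in X &, forall x y, edge x y -> g x = g y} ->
  (forall k, ratio_le c (X :&: [set x | g x == k])) -> ratio_le c X.
Proof.
move=> c0 gX bX; apply/ratio_leP => Y sYX.
pose F k := [set x | g x == k].
have [I IP] := fin_all_exists (fun k => alpha_in_attained (Y :&: F k)).
pose J := [set x | x \in I (g x)].
have IY k x : x \in I k -> x \in Y /\ g x = k.
  by case: (IP k) => /subsetP s _ _ /s; rewrite !inE => /andP[-> /eqP].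
have JI k : J :&: F k = I k.
  apply/setP => x; rewrite !inE; apply/andP/idP => [[+ /eqP <-//]|xI].
  by have [_ ->] := IY _ _ xI.
have sJY : J \subset Y by apply/subsetP => x; rewrite inE => /IY[].
have iJ : independent J.
  apply/independentP => x y; rewrite !inE => xI yI; apply/negP => xy.
  have eg : g x = g y.
    apply: gX => //; apply: (subsetP sYX).
      by case: (IY _ _ xI).
    by case: (IY _ _ yI).
  case: (IP (g y)) => _ /independentP/(_ x y); rewrite -{1}eg => /(_ xI yI).
  by rewrite xy.
apply: (le_trans (y := c * #|J|%:R)); last first.
  by apply: ler_wpM2l => //; rewrite ler_nat leq_alpha_in.
rewrite (card_fibers g Y) (card_fibers g J) !natr_sum mulr_sumr.
apply: ler_sum => k _; rewrite -/(F k) JI; case: (IP k) => _ _ ->.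
by move/ratio_leP: (bX k); apply; apply: setSI.
Qed.

Definition closed_nbhd I := [set y | [exists x in I, (y == x) || edge x y]].

(** Take a smallest violating [Y]. Deleting the closed neighbourhood of [I] leaves a set that obeys
    the bound and whose independent sets can be enlarged by [I]. So [alpha_in] drops by at least
    [|I|], and more than [c|I|] vertices were deleted. *)
Lemma ratio_critical c X : 0 <= c -> ~~ ratio_le c X ->
  exists Y, [/\ Y \subset X, c * (alpha_in Y)%:R < #|Y|%:R &
    forall I, I \subset Y -> independent I -> I != set0 ->
      c * #|I|%:R < #|Y :&: closed_nbhd I|%:R].
Proof.
move=> c0 /forallPn[Y0]; rewrite negb_imply -ltNge => Y0P.
pose P Y := (Y \subset X) && (c * (alpha_in Y)%:R < #|Y|%:R).
have [Y /andP[sYX bY] minY] := @arg_minnP _ Y0 P (fun Y => #|Y|) Y0P.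
exists Y; split=> // I sIY iI /set0Pn[x xI].
set N := closed_nbhd I; pose Y' := Y :\: N.
have IN : I \subset N.
  by apply/subsetP => y yI; rewrite inE; apply/existsP; exists y; rewrite yI eqxx.
have ltY' : (#|Y'| < #|Y|)%N.
  apply: proper_card; apply/properP; split; first exact: subsetDl.
  by exists x; [apply: (subsetP sIY)|rewrite in_setD (subsetP IN)].
have bY' : #|Y'|%:R <= c * (alpha_in Y')%:R.
  rewrite leNgt; apply/negP => bY'; have /minY : P Y'.
    by rewrite /P bY' andbT (subset_trans _ sYX)// subsetDl.
  by rewrite leqNgt ltY'.
have : (alpha_in Y' + #|I| <= alpha_in Y)%N.
  have [J [sJY' iJ <-]] := alpha_in_attained Y'.
  have dIJ : I :&: J = set0.
    apply/setP => y; rewrite !inE; apply/andP => -[yI /(subsetP sJY')].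
    by rewrite inE (subsetP IN).
  rewrite addnC -[(_ + _)%N]subn0 -(cards0 G) -dIJ -cardsU.
  apply: leq_alpha_in; first by rewrite subUset sIY (subset_trans sJY')// subsetDl.
  have nIJ y z : y \in I -> z \in J -> ~~ edge y z.
    move=> yI /(subsetP sJY'); rewrite inE => /andP[+ _].
    by apply: contra => yz; rewrite inE; apply/existsP; exists y; rewrite yI yz orbT.
  apply/independentP => y z; rewrite !inE => /orP[yI|yJ] /orP[zI|zJ].
  - exact: (independentP iI).
  - exact: nIJ.
  - by rewrite edge_sym nIJ.
  - exact: (independentP iJ).
rewrite -(ler_nat R) natrD => /(ler_wpM2l c0); rewrite mulrDr => aY.
move: bY; rewrite -(cardsID N Y) natrD -/Y'; move: aY bY'.
lra.
Qed.

(** When [t] vertices are exhausted, they contain an independent [I] with [k|I| >= t]. Its closed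
    neighbourhood in the critical set has more than [c|I| >= 2t] vertices, all exhausted or on the
    stack, so the stack holds more than [t]. *)
Lemma long_path (k c : R) (t : nat) X : 0 < k -> 2 * k <= c -> (0 < t)%N ->
  (forall Z : {set G}, Z != set0 -> (#|Z| <= t)%N -> #|Z|%:R <= k * (alpha_in Z)%:R) ->
  ~~ ratio_le c X ->
  exists p : seq G,
    [/\ sorted (@edge G) p, uniq p, {subset p <= X} & (t < size p)%N].
Proof.
move=> k0 lekc t0 small /(ratio_critical (c := c)) []; first by lra.
move=> Y [/subsetP sYX bY expand].
have Y0 : Y != set0.
  apply: contraTneq bY => ->; rewrite -leNgt cards0 mulr_ge0//; lra.
(* The search needs [t] vertices to exhaust; a smaller [Y] would obey the bound for small sets, and
   [k <= c]. *)
have ltY : (t < #|Y|)%N.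
  rewrite ltnNge; apply/negP => /(small Y Y0) sm.
  have : k * (alpha_in Y)%:R <= c * (alpha_in Y)%:R by apply: ler_wpM2r => //; lra.
  lra.
have [S [p [[cS sSY pY [srt up]] sep]]] := dfs_separation (@edge_sym G) (ltnW ltY).
exists p; split=> //; first by move=> x /pY/sYX.
have S0 : S != set0 by rewrite -card_gt0 cS.
have := small S S0; rewrite cS => /(_ (leqnn _)).
have [I [sIS iI <-]] := alpha_in_attained S => tI.
have I0 : I != set0.
  apply: contraTneq tI => ->; rewrite cards0 mulr0 -ltNge.
  by rewrite ltr0n.
have := expand I (subset_trans sIS sSY) iI I0 => big.
have : (#|Y :&: closed_nbhd I| <= t + size p)%N.
  rewrite -cS -(card_uniqP up) -(cardsE (mem p)).
  apply: leq_trans (leq_card_setU _ _).1; apply/subset_leq_card/subsetP => y.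
  rewrite !inE => /andP[yY /existsP[x /andP[xI /orP[/eqP->|xy]]]].
    by rewrite (subsetP sIS).
  by case: (sep x y (subsetP sIS x xI) yY xy) => ->; rewrite ?orbT.
rewrite -(ler_nat R) natrD => le_tp; rewrite -(ltr_nat R).
have : 2 * (k * #|I|%:R) <= c * #|I|%:R by rewrite mulrA; apply: ler_wpM2r.
lra.
Qed.
End RatioLe.

(** * From a large ratio to cycles through the breadth-first layers *)

Section Assembly.
Local Open Scope ring_scope.
Variables (R : realFieldType) (G : sgraph) (L : layering (@edge G)).

Definition layer_edge : rel G := [rel x y | edge x y && (depth L x == depth L y)].

Definition layer_component (r : G) := [set x | connect layer_edge r x].

Lemma layer_edge_sym : symmetric layer_edge.
Proof. by move=> x y; rewrite /layer_edge /= edge_sym eq_sym. Qed.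

Lemma layer_component_depth r : {in layer_component r, forall x, depth L x = depth L r}.
Proof.
move=> x; rewrite inE => rx; apply/esym/eqP.
have cl : closed layer_edge [pred y | depth L r == depth L y].
  by move=> y z /andP[_ /eqP]; rewrite !inE => ->.
by have := closed_connect cl rx; rewrite !inE eqxx => <-.
Qed.

Lemma layer_component_connect r : {in layer_component r &, forall x y,
  connect [rel x y | edge x y && (y \in layer_component r)] x y}.
Proof.
move=> x y rx; rewrite inE => ry.
have /connectP[q] : connect layer_edge x y.
  rewrite inE (sym_connect_sym layer_edge_sym) in rx.
  exact: connect_trans ry.
elim: q x rx {ry} => [|z q IHq] x rx /= => [_ ->|/andP[xz zq] ey]; first exact: connect0.
have rz : z \in layer_component r.
  by move: rx; rewrite !inE => /connect_trans; apply; apply: connect1.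
apply: connect_trans (IHq z rz zq ey); apply: connect1.
by case/andP: xz => /= -> _.
Qed.

(** Depths of adjacent vertices differ by at most one, so within a parity class edges stay in a
    layer and the fibers lie in layer components. The two classes double the bound. *)
Lemma ratio_le_layers (c : R) : 0 <= c ->
  (forall r, ratio_le c (layer_component r)) -> ratio_le (c + c) [set: G].
Proof.
move=> c0 bH.
have parity b : ratio_le c [set x | odd (depth L x) == b].
  apply: (ratio_le_fibers (g := fingraph.root layer_edge)) => // [x y|r].
    rewrite !inE => /eqP ox /eqP oy xy.
    apply/(fingraph.rootP (sym_connect_sym layer_edge_sym))/connect1.
    rewrite /layer_edge /= xy /=; apply/eqP.
    have := depth_edge L xy; rewrite edge_sym in xy; have := depth_edge L xy.
    by move: ox oy; lia.
  apply: ratio_leS (bH r); apply/subsetP => x; rewrite !inE => /andP[_ /eqP <-].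
  by rewrite (sym_connect_sym layer_edge_sym) connect_root.
apply: ratio_leS (ratio_leU c0 c0 (parity true) (parity false)).
by apply/subsetP => x _; rewrite !inE; case: odd.
Qed.

(** The factor 4 pays for two halvings: the parity of the layers and the split of a component into
    [A] and the rest. *)
Lemma cycles_of_ratio (k c : R) (t : nat) : 0 < k -> 2 * k <= c -> 1 <= c -> (0 < t)%N ->
  (forall Z : {set G}, Z != set0 -> (#|Z| <= t)%N -> #|Z|%:R <= k * (alpha_in Z)%:R) ->
  ~~ ratio_le (4 * c) [set: G] ->
  exists m, forall s, (s.*2 <= t)%N ->
    exists c, [/\ (3 <= size c)%N, ucycle (@edge G) c & size c = (m + s)%N].
Proof.
move=> k0 lekc c1 t0 small nb.
have [r nbH] : exists r, ~~ ratio_le (c + c) (layer_component r).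
  apply/existsP; rewrite -negb_forall; apply: contra nb => /forallP bH.
  have -> : 4 * c = (c + c) + (c + c) by lra.
  by apply: ratio_le_layers => //; lra.
set H := layer_component r in nbH.
have H1 : (1 < #|H|)%N.
  rewrite ltnNge; apply: contra nbH => leH1; apply/ratio_leP => Y sYH.
  have [->|Y0] := eqVneq Y set0; first by rewrite cards0 mulr_ge0//; lra.
  have : 1 <= (alpha_in Y)%:R :> R by rewrite ler1n alpha_in_gt0.
  have : #|Y|%:R <= 1 :> R by rewrite -[1]/1%:R ler_nat (leq_trans (subset_leq_card sYH)).
  by nra.
have cH : {in H &, forall x y, connect (@edge G) x y}.
  move=> x y xH yH; apply: connect_sub (layer_component_connect xH yH) => v w /andP[vw _].
  exact: connect1.
have [A [n [sAH A0 B0 n0 tree]]] :=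
  layer_split (@edge_sym G) (@layer_component_depth r) cH H1.
have sBH : H :\: A \subset H by apply: subsetDl.
have dAB : [disjoint A & H :\: A].
  by rewrite -setI_eq0; apply/eqP/setP => x; rewrite !inE; case: (x \in A).
(* Either part may be the one of large ratio, so the argument is made for a long path in [X] and a
   target [Y]. *)
have cycles (X Y : {set G}) : X \subset H -> Y \subset H -> [disjoint X & Y] -> Y != set0 ->
    (forall a b, a \in X -> b \in Y -> exists u, [/\ size u = n,
      path (@edge G) b (rcons u a), uniq u & {in u, forall x, (depth L x < depth L r)%N}]) ->
    ~~ ratio_le c X ->
    exists m, forall s, (s.*2 <= t)%N ->
      exists c, [/\ (3 <= size c)%N, ucycle (@edge G) c & size c = (m + s)%N].
  move=> sXH sYH dXY Y0 treeXY nbX.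
  have [p [srt up pX ltp]] := long_path k0 lekc t0 small nbX.
  have [|m mP] := consecutive_cycles (@edge_sym G) sXH sYH dXY Y0
    (@layer_component_connect r) n0 _ srt up pX.
    move=> a b aX bY; have [u [su pu uu du]] := treeXY a b aX bY; exists u; split=> //.
    by move=> x /du; apply: contraL => /layer_component_depth ->; rewrite ltnn.
  by exists m => s les; apply: mP; apply: leq_ltn_trans ltp.
have [bA|nbA] := boolP (ratio_le c A).
  apply: (cycles (H :\: A) A) => //; first by rewrite disjoint_sym.
    by move=> a b aX bY; apply: tree.
  apply: contra nbH => bB; have c0 : 0 <= c by lra.
  apply: ratio_leS (ratio_leU c0 c0 bA bB).
  by apply/subsetP => x xH; rewrite in_setU in_setD xH andbT orbN.
apply: (cycles A (H :\: A)) => // a b aA bB.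
have [u [su pu uu du]] := tree a b aA bB.
(* The tree paths run from [A] to the rest; with the long path in [A] they are needed in the other
   direction. *)
exists (rev u); split; rewrite ?size_rev ?rev_uniq//.
  have := rev_path (@edge G) a (rcons u b).
  rewrite last_rcons belast_rcons rev_cons => ->.
  by rewrite (eq_path (e' := @edge G))// => x y; apply: edge_sym.
by move=> x; rewrite mem_rev => /du.
Qed.
End Assembly.

(* Real suprema, the speed of a property and the theorem *)
From mathcomp Require Import all_classical.
From mathcomp Require Import reals.

Local Open Scope classical_set_scope.
Local Open Scope ring_scope.

(** The supremum is genuine: nonempty sets have independence number at least 1, so all ratios are at
    most [|G|]. *)
Lemma le_indep_ratio (R : realType) (G : sgraph) (X : {set G}) : X != finset.set0 ->
  #|X|%:R <= indep_ratio R G * (alpha_in X)%:R.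
Proof.
move=> X0; have a0 : 0 < (alpha_in X)%:R :> R by rewrite ltr0n alpha_in_gt0.
rewrite -ler_pdivrMr//; apply: ub_le_sup; last by exists X; rewrite ?alpha_induced.
exists #|G|%:R => _ [Y Y0 <-]; rewrite alpha_induced.
have aY : 0 < (alpha_in Y)%:R :> R by rewrite ltr0n alpha_in_gt0.
rewrite ler_pdivrMr// -natrM ler_nat (leq_trans (max_card _))//.
by rewrite leq_pmulr// alpha_in_gt0.
Qed.

Lemma lt_indep_ratio (R : realType) (G : sgraph) (c : R) : 0 <= c ->
  c < indep_ratio R G -> ~~ ratio_le c [set: G]%SET.
Proof.
move=> c0 ltc; apply/negP => /ratio_leP bG; move: ltc; apply/negP; rewrite -leNgt.
rewrite /indep_ratio; set E := (X in sup X).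
(* Without vertices the supremum is 0 by convention, which [0 <= c] covers. *)
have [->|/set0P ne] := eqVneq E set0; first by rewrite sup0.
apply: ge_sup => // _ [X X0 <-]; rewrite alpha_induced.
by rewrite ler_pdivrMr ?ltr0n ?alpha_in_gt0// bG// finset.subsetT.
Qed.

(** The speed is applied to the induced subgraph, of order [|X|], and its ratio is compared with
    that of its whole vertex set. *)
Lemma speed_bound (R : realType) (f : R -> R) (P : sgraph -> Prop) (G : sgraph)
    (X : {set G}) : hereditary P -> speed_at_most f P -> P G -> X != finset.set0 ->
  #|X|%:R <= f #|X|%:R * (alpha_in X)%:R.
Proof.
move=> [_ hP] sP PG X0.
have cX : #|induced X| = #|X| by rewrite card_sig.
have X1 : (0 < #|X|)%N by rewrite card_gt0.
have T0 : [set: induced X]%SET != finset.set0 by rewrite -card_gt0 cardsT cX.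
have := le_indep_ratio R T0; rewrite cardsT cX alpha_in_setT alpha_induced.
move/le_trans; apply; apply: ler_wpM2r => //.
exact: sP X1 cX (hP _ _ PG).
Qed.

Theorem theorem2 (R : realType) (f : R -> R) (P : sgraph -> Prop) (k : R)
    (G : sgraph) :
  set_bij `[1, +oo[ `[1, +oo[ f ->
  {in `[1, +oo[ &, {homo f : x y / x < y}} ->
  hereditary P ->
  speed_at_most f P ->
  1 <= k ->
  P G ->
  18 * k + 4 < indep_ratio R G ->
  exists m : int, forall l : int,
    m <= l -> l%:~R < m%:~R + 'pinv_(fun=> 1) `[1, +oo[ f k / 2 :> R ->
    has_cycle G l.
Proof.
move=> bij_f incr_f hP sP k1 PG big.
set x := 'pinv_(fun=> 1) `[1, +oo[ f k.
(* Since [k] lies in the image of [f], the partial inverse is a true one there: [1 <= x] and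
   [f x = k]. *)
have k_in : k \in [set` `[1, +oo[%R] by rewrite inE /= in_itv /= k1.
have x1 : 1 <= x.
  have [h _ _] := bijpinv_bij (fun=> 1) bij_f.
  have := h k (set_mem k_in); rewrite /= in_itv /= andbT; exact.
have fx : f x = k.
  have [_ _ surj_f] := bij_f.
  exact: (surjpK (fun=> 1) surj_f).
have [L] := layering_exists (@edge_sym G).
have /andP[le_tx lt_xt] : (Num.truncn x)%:R <= x < (Num.truncn x).+1%:R.
  by apply: truncn_itv; lra.
set t := Num.truncn x in le_tx lt_xt.
have t0 : (0 < t)%N by rewrite truncn_gt0.
(* By monotonicity, [|Z| <= t <= x] gives [f |Z| <= f x = k]. *)
have small (Z : {set G}) : Z != finset.set0 -> (#|Z| <= t)%N ->
    #|Z|%:R <= k * (alpha_in Z)%:R.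
  move=> Z0 leZt; apply: (le_trans (speed_bound hP sP PG Z0)).
  apply: ler_wpM2r => //; rewrite -fx.
  have Z1 : 1 <= #|Z|%:R :> R by rewrite ler1n card_gt0.
  have : #|Z|%:R <= x by apply: le_trans le_tx; rewrite ler_nat.
  rewrite le_eqVlt => /orP[/eqP -> //|ltZx]; apply/ltW/incr_f => //.
    by rewrite in_itv /= Z1.
  by rewrite in_itv /= x1.
(* This [c] equals [9k/2 + 1], hence is at least [2k] and 1. *)
have [||||m mP] := cycles_of_ratio (c := (18 * k + 4) / 4) L _ _ _ t0 small; [lra..| |].
  have -> : 4 * ((18 * k + 4) / 4) = 18 * k + 4 by lra.
  by apply: lt_indep_ratio => //; lra.
exists m => l; rewrite -subr_ge0; case Es : (l - m%:Z) => [s|//] _.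
have -> : l = (m + s)%N by lia.
rewrite -!pmulrn natrD ltrD2l ltr_pdivlMr// => lts.
have [|c [c3 uc sc]] := mP s; last first.
  by exists c; split; rewrite // sc PoszD.
(* From [2s < x < t + 1] integrality gives [2s <= t]. *)
rewrite -ltnS -(ltr_nat R) -muln2 natrM; exact: lt_trans lts lt_xt.
Qed.
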